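(* Let $X\sim N_d(\theta,\sigma_X^2 I_d)$ and $Y\sim N_d(\theta,\sigma_Y^2 I_d)$ be independent, with $\theta\in C\subset\mathbb{R}^d$ unknown and $\sigma_X^2,\sigma_Y^2>0$ known. Let $\hat\theta(X)$ be a non-degenerate estimator of $\theta$, and for $c\ge1$ let $q_{\hat\theta,c}(\cdot;X)$ be the density of $N_d(\hat\theta(X),c^2\sigma_Y^2I_d)$. Let $\alpha_0\in(-1,0]$, suppose $\epsilon(\alpha_0)>0$, and let $c>1$ satisfy $c^2\in(1,k(d,\alpha_0,\sigma_X^2,\sigma_Y^2)]$. Then the predictive density $q_{\hat\theta,c}$ dominates the plug-in density $q_{\hat\theta,1}$ for Kullback-Leibler loss $L_{-1}$ as well as for all other losses $L_\alpha$ with $-1<\alpha\le\alpha_0$.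
   Context: Let $q(\cdot|\theta)$ be the density of $N_d(\theta,\sigma_Y^2 I_d)$. Let $h_\alpha(z)=\frac{4}{1-\alpha^2}\left(1-z^{(1+\alpha)/2}\right)$ for $|\alpha|<1$ and $h_{-1}(z)=-\log z$. The $\alpha$-divergence loss of a predictive density $\hat q(\cdot;x)$ is $L_\alpha(\theta,\hat q(\cdot;x))=\int_{\mathbb{R}^d}h_\alpha\!\left(\frac{\hat q(y;x)}{q(y|\theta)}\right)q(y|\theta)\,dy$ ($L_{-1}$ is Kullback-Leibler loss), and its frequentist risk is $R_\alpha(\theta,\hat q)=\mathbb{E}_\theta[L_\alpha(\theta,\hat q(\cdot;X))]$, where $\mathbb{E}_\theta$ is the expectation over $X\sim N_d(\theta,\sigma_X^2I_d)$. $\hat q_1$ dominates $\hat q_2$ under $L_\alpha$ if $R_\alpha(\theta,\hat q_1)\le R_\alpha(\theta,\hat q_2)$ for all $\theta\in C$, with strict inequality for at least one $\theta\in C$. An estimator is non-degenerate if it is not almost surely constant. With $Z=\|\hat\theta(X)-\theta\|^2/\sigma_Y^2$, set $\epsilon(\alpha)=\inf_{\theta\in C}\mathbb{E}_\theta\left(Ze^{-(1-\alpha^2)Z/8}\right)$, $\tau=(1-\alpha)\epsilon(\alpha)-2\alpha d$, and $$k(d,\alpha,\sigma_X^2,\sigma_Y^2)=\frac{\tau+\sqrt{\tau^2+4d^2(1-\alpha^2)}}{2d(1-\alpha)}.$$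
   Formalization: For Kullback-Leibler loss, strict inequality at some θ is claimed only if the risk of the plug-in density is finite for at least one θ in C (otherwise both risks are infinite everywhere and strictness fails); the weak inequality holds unconditionally. *)

(* Defs.v *)
From HB Require Import structures.
From mathcomp Require Import all_boot all_order all_algebra.
From mathcomp Require Import all_classical all_reals all_analysis.
From mathcomp Require Import measurable_realfun.
Set Implicit Arguments.
Unset Strict Implicit.
Unset Printing Implicit Defensive.
Import Order.TTheory GRing.Theory Num.Theory.
Import numFieldNormedType.Exports.
Local Open Scope classical_set_scope.
Local Open Scope ring_scope.
Local Open Scope ereal_scope.

Section sigma_finite_measure_of.
Context d (T : measurableType d) (R : realType).
Implicit Types nu : set T -> \bar R.

Definition is_sigma_finite_measure nu : Prop :=
  [/\ nu set0 = 0, forall A, 0 <= nu A, semi_sigma_additive nu &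
      sigma_finite setT nu].

Definition sigma_finite_measure_of nu (_ : is_sigma_finite_measure nu) := nu.

Variables (nu : set T -> \bar R) (h : is_sigma_finite_measure nu).

HB.instance Definition _ :=
  isMeasure.Build _ _ _ (sigma_finite_measure_of h)
    (let: And4 h0 _ _ _ := h in h0)
    (let: And4 _ h1 _ _ := h in h1)
    (let: And4 _ _ h2 _ := h in h2).

HB.instance Definition _ :=
  Measure_isSigmaFinite.Build _ _ _ (sigma_finite_measure_of h)
    (let: And4 _ _ _ h3 := h in h3).

End sigma_finite_measure_of.

Lemma pushforward_sigma_finite d1 d2 d3 (T1 : measurableType d1)
    (T2 : measurableType d2) (T3 : measurableType d3) (R : realType)
    (m1 : {sigma_finite_measure set T1 -> \bar R})
    (m2 : {sigma_finite_measure set T2 -> \bar R})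
    (f : T1 * T2 -> T3) (g : T3 -> T1 * T2) :
  measurable_fun setT f -> measurable_fun setT g -> cancel f g ->
  is_sigma_finite_measure (pushforward (m1 \x m2) f).
Proof.
move=> mf mg fK; split.
- by rewrite /pushforward preimage_set0 measure0.
- by move=> A; exact: measure_ge0.
- move=> F mF tF mUF; rewrite /pushforward preimage_bigcup.
  apply: measure_semi_sigma_additive.
  + by move=> k; rewrite -[X in measurable X]setTI; exact: mf.
  + apply/trivIsetP => /= i j _ _ ij; rewrite -preimage_setI.
    by move/trivIsetP : tF => /(_ _ _ _ _ ij) ->//; rewrite preimage_set0.
  + by rewrite -preimage_bigcup -[X in measurable X]setTI; exact: mf.
- have [F FT Foo] : sigma_finite setT (m1 \x m2).
    have /sigma_finiteP[F [TF ndF Foo]] := sigma_finiteT m1.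
    have /sigma_finiteP[G [TG ndG Goo]] := sigma_finiteT m2.
    exists (fun n => F n `*` G n).
      rewrite -setXTT TF TG predeqE => -[x y]; split.
        move=> [/= [n _ Fnx] [k _ Gky]]; exists (maxn n k) => //; split.
        - by move: x Fnx; exact/subsetPset/ndF/leq_maxl.
        - by move: y Gky; exact/subsetPset/ndG/leq_maxr.
      by move=> [n _ []/= ? ?]; split; exists n.
    move=> k; have [? ?] := Foo k; have [? ?] := Goo k.
    split; first exact: measurableX.
    by rewrite product_measure1E// lte_mul_pinfty// ge0_fin_numE.
  exists (fun k => g @^-1` F k).
    by rewrite -preimage_bigcup -FT preimage_setT.
  move=> k; have [mFk Fkoo] := Foo k; split.
    by rewrite -[X in measurable X]setTI; exact: mg.
  rewrite /pushforward -comp_preimage (_ : g \o f = id) ?preimage_id//.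
  by apply/funext => p /=; exact: fK.
Qed.

Section lebesgue_tuple.
Context (R : realType).

Definition cons_pair (n : nat) (p : measurableTypeR R * n.-tuple R) :
  n.+1.-tuple R := [tuple of p.1 :: p.2].

Lemma measurable_cons_pair (n : nat) : measurable_fun setT (@cons_pair n).
Proof.
apply: measurable_cons; [exact: measurable_fst|exact: measurable_snd].
Qed.

(* Points of R^n are n-tuples; lebesgue_tuple n is the n-fold product of
   the one-dimensional Lebesgue measure. *)
Fixpoint lebesgue_tuple (n : nat) : set (n.-tuple R) -> \bar R :=
  match n with
  | 0 => \d_([tuple] : 0.-tuple R)
  | m.+1 =>
      pushforward (@lebesgue_measure R \x @lebesgue_tuple m) (@cons_pair m)
  end.

Let uncons (n : nat) (t : n.+1.-tuple R) : measurableTypeR R * n.-tuple R :=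
  (thead t, [tuple of behead t]).

Let measurable_uncons (n : nat) : measurable_fun setT (@uncons n).
Proof.
apply/measurable_fun_pairP; split; first exact: measurable_tnth.
exact: measurable_behead.
Qed.

Let cons_pairK (n : nat) : cancel (@cons_pair n) (@uncons n).
Proof.
by case=> a t; rewrite /uncons /cons_pair /= theadE; congr pair; exact: val_inj.
Qed.

Lemma lebesgue_tuple_sigma_finite (n : nat) :
  is_sigma_finite_measure (@lebesgue_tuple n).
Proof.
elim: n => [|n h].
  split; [exact: measure0|exact: measure_ge0| |exact: sigma_finiteT].
  exact: measure_semi_sigma_additive.
exact: (pushforward_sigma_finite (@lebesgue_measure R)
  (sigma_finite_measure_of h)
  (@measurable_cons_pair n) (@measurable_uncons n) (@cons_pairK n)).
Qed.

HB.instance Definition _ (n : nat) :=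
  SigmaFiniteMeasure.copy (@lebesgue_tuple n)
    (sigma_finite_measure_of (@lebesgue_tuple_sigma_finite n)).

End lebesgue_tuple.
Arguments lebesgue_tuple {R} n.

Section gaussian.
Context (R : realType) (d : nat).
Implicit Types (x y theta : d.-tuple R) (v : R).

Definition sqdist x y : R :=
  (\sum_(i < d) (tnth x i - tnth y i) ^+ 2)%R.

(* Density of N_d(theta, v I_d); v is the variance, not the standard
   deviation. *)
Definition gauss_pdf theta v y : R :=
  ((2 * pi * v) `^ (- (d%:R / 2)) * expR (- sqdist y theta / (2 * v)))%R.

Definition gauss_law theta v : set (d.-tuple R) -> \bar R :=
  fun A => \int[lebesgue_tuple d]_(y in A) (gauss_pdf theta v y)%:E.

Lemma gauss_pdf_ge0 theta v y : (0 <= gauss_pdf theta v y)%R.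
Proof. by rewrite mulr_ge0 ?powR_ge0 ?expR_ge0. Qed.

Lemma measurable_gauss_pdf theta v : measurable_fun setT (gauss_pdf theta v).
Proof.
apply: measurable_funM => //; apply: measurableT_comp => //.
apply: measurable_funM => //; apply: measurableT_comp => //.
apply: measurable_sum => i; apply: measurable_funX.
by apply: measurable_funB => //; exact: measurable_tnth.
Qed.

Let gauss_law0 theta v : gauss_law theta v set0 = 0.
Proof. exact: integral_set0. Qed.

Let gauss_law_ge0 theta v A : 0 <= gauss_law theta v A.
Proof. by apply: integral_ge0 => y _; rewrite lee_fin gauss_pdf_ge0. Qed.

Let gauss_law_sigma_additive theta v : semi_sigma_additive (gauss_law theta v).
Proof.
move=> F mF tF mUF; rewrite /gauss_law ge0_integral_bigcup//=.
- by apply: is_cvg_ereal_nneg_natsum_cond => n _ _; exact: gauss_law_ge0.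
- apply: measurable_funTS; apply/measurable_EFinP.
  exact: measurable_gauss_pdf.
- by move=> y _; rewrite lee_fin gauss_pdf_ge0.
Qed.

HB.instance Definition _ theta v :=
  isMeasure.Build _ _ _ (gauss_law theta v) (gauss_law0 theta v)
    (gauss_law_ge0 theta v) (@gauss_law_sigma_additive theta v).

End gaussian.

Lemma sqdist_cons (R : realType) (d : nat) (y theta : d.+1.-tuple R) :
  sqdist y theta = ((thead y - thead theta) ^+ 2 +
    sqdist [tuple of behead y] [tuple of behead theta])%R.
Proof.
rewrite /sqdist big_ord_recl; congr (_ + _)%R; apply: eq_bigr => i _.
rewrite !tnth_behead; suff -> : inord i.+1 = lift ord0 i by [].
by apply: val_inj; rewrite /= inordK ?ltnS.
Qed.

Lemma gauss_pdf_cons (R : realType) (d : nat) (theta : d.+1.-tuple R) (v : R)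
    (a : R) (t : d.-tuple R) : (0 < v)%R ->
  gauss_pdf theta v [tuple of a :: t] =
  (normal_pdf (thead theta) (Num.sqrt v) a *
   gauss_pdf [tuple of behead theta] v t)%R.
Proof.
move=> v0; rewrite /gauss_pdf sqdist_cons theadE normal_pdfE ?gt_eqF ?sqrtr_gt0//.
rewrite /normal_peak /normal_fun sqr_sqrtr ?ltW//.
have -> : [tuple of behead [tuple of a :: t]] = t by exact: val_inj.

set w := ((_ - _) ^+ 2)%R; set z := sqdist _ _.
have -> : (- (w + z) / (2 * v) = - w / (2 * v) + - z / (2 * v))%R by rewrite opprD mulrDl.
rewrite expRD.
have p0 : (0 < 2 * pi * v)%R by rewrite !mulr_gt0 ?pi_gt0.
have -> : (- (d.+1%:R / 2) = - (d%:R / 2) + - (2^-1) :> R)%R.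
  by rewrite -[in LHS]addn1 natrD mulrDl opprD div1r.
rewrite powRD; last by rewrite (gt_eqF p0) implybT.
have -> : ((2 * pi * v) `^ (- 2^-1) = ((Num.sqrt (v * pi *+ 2))^-1))%R.
  rewrite powRN powR12_sqrt ?ltW//; congr (Num.sqrt _)^-1%R.
  by rewrite -[RHS]mulr_natl (mulrC v) mulrA.
rewrite -[(v *+ 2)%R]mulr_natl [X in (X * _ = _)%R]mulrC.
by rewrite mulrACA.
Qed.

Lemma gauss_law_setT (R : realType) (d : nat) (theta : d.-tuple R) (v : R) :
  (0 < v)%R -> gauss_law theta v setT = 1.
Proof.
move=> v0.
have mpdf n th : measurable_fun setT (fun y => (@gauss_pdf R n th v y)%:E).
  by apply/measurable_EFinP; exact: measurable_gauss_pdf.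
elim: d theta => [|d IH] theta.
  rewrite /gauss_law /= integral_dirac//; last exact: mpdf.
  rewrite diracT mul1e.
  by rewrite /gauss_pdf /sqdist big_ord0 oppr0 !mul0r oppr0 powRr0 expR0 mulr1.
rewrite /gauss_law /= (@ge0_integral_pushforward _ _ _ _ _ _
  (@measurable_cons_pair R d))//=; last 2 first.
- exact: mpdf.
- by move=> y _; rewrite lee_fin gauss_pdf_ge0.
have FT := (@fubini_tonelli1 _ _ _ _ R (@lebesgue_measure R) (lebesgue_tuple d)
  (fun p => (gauss_pdf theta v (cons_pair p))%:E)).
rewrite [LHS]FT.
- rewrite /fubini_F /=.
  rewrite -[RHS](integral_normal_pdf (thead theta) (Num.sqrt v)).
  apply: eq_integral => a _.
  under eq_integral => t _ do rewrite gauss_pdf_cons// EFinM.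
  transitivity (\int[lebesgue_tuple d]_t ((normal_pdf (thead theta) (Num.sqrt v) a)%:E *
     (gauss_pdf [tuple of behead theta] v t)%:E)) => //.
  rewrite ge0_integralZl//=.
  - by have := IH [tuple of behead theta]; rewrite /gauss_law => ->; rewrite mule1.
  - exact: mpdf.
  - by move=> t _; rewrite lee_fin gauss_pdf_ge0.
  - by rewrite lee_fin normal_pdf_ge0.
- exact: (measurableT_comp (mpdf _ _) (@measurable_cons_pair R d)).
- by move=> p; rewrite lee_fin gauss_pdf_ge0.
Qed.

Section predictive_density.
Context (R : realType) (d : nat).
Implicit Types (theta : d.-tuple R) (C : set (d.-tuple R)).

(* The divergence function h_alpha, meant for -1 <= alpha < 1. *)
Definition alpha_h (alpha z : R) : R :=
  (if alpha == -1 then - ln z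
   else 4 / (1 - alpha ^+ 2) * (1 - z `^ ((1 + alpha) / 2)))%R.

Definition alpha_loss (alpha vY : R) theta (qhat : d.-tuple R -> R) : \bar R :=
  \int[lebesgue_tuple d]_y
    (alpha_h alpha (qhat y / gauss_pdf theta vY y) * gauss_pdf theta vY y)%:E.

(* A predictive density qhat maps the observation x to a density
   qhat x : R^d -> R. The risk is extended-real valued; it can be +oo when
   alpha = -1. *)
Definition alpha_risk (alpha vX vY : R) theta
    (qhat : d.-tuple R -> d.-tuple R -> R) : \bar R :=
  \int[gauss_law theta vX]_x alpha_loss alpha vY theta (qhat x).

Definition no_worse C (alpha vX vY : R)
    (qhat1 qhat2 : d.-tuple R -> d.-tuple R -> R) : Prop :=
  forall theta, C theta ->
    alpha_risk alpha vX vY theta qhat1 <= alpha_risk alpha vX vY theta qhat2.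

Definition dominates_risk C (alpha vX vY : R)
    (qhat1 qhat2 : d.-tuple R -> d.-tuple R -> R) : Prop :=
  no_worse C alpha vX vY qhat1 qhat2 /\
  exists2 theta, C theta &
    alpha_risk alpha vX vY theta qhat1 < alpha_risk alpha vX vY theta qhat2.

(* The density of N_d(T(x), c^2 vY I_d); c = 1 gives the plug-in density. *)
Definition plugin_density (vY : R) (T : d.-tuple R -> d.-tuple R) (c : R)
    (x : d.-tuple R) : d.-tuple R -> R :=
  gauss_pdf (T x) (c ^+ 2 * vY).

(* The laws N_d(theta, vX I_d) have the same null sets, so that
   "almost surely" does not depend on theta. *)
Definition non_degenerate C (vX : R) (T : d.-tuple R -> d.-tuple R) : Prop :=
  ~ exists a, forall theta, C theta ->
      {ae gauss_law theta vX, forall x, T x = a}.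

Definition epsilon C (vX vY : R) (T : d.-tuple R -> d.-tuple R)
    (alpha : R) : \bar R :=
  ereal_inf [set \int[gauss_law theta vX]_x
               (let Z := sqdist (T x) theta / vY in
                Z * expR (- ((1 - alpha ^+ 2) * Z / 8)))%:E
            | theta in C].

(* For |alpha| < 1 the integrand of epsilon is bounded, so that epsilon is
   finite as soon as C is nonempty and fine loses nothing. *)
Definition tau C (vX vY : R) (T : d.-tuple R -> d.-tuple R) (alpha : R) : R :=
  ((1 - alpha) * fine (epsilon C vX vY T alpha) - 2 * alpha * d%:R)%R.

Definition k_bound C (vX vY : R) (T : d.-tuple R -> d.-tuple R)
    (alpha : R) : R :=
  let t := tau C vX vY T alpha in
  ((t + Num.sqrt (t ^+ 2 + 4 * d%:R ^+ 2 * (1 - alpha ^+ 2))) /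
     (2 * d%:R * (1 - alpha)))%R.

End predictive_density.

(* Main.v *)
Require Import Defs.
From mathcomp Require Import all_boot all_order all_algebra.
From mathcomp Require Import all_classical all_reals all_analysis.
From mathcomp Require Import measurable_realfun.
From mathcomp Require Import ring lra.
Set Implicit Arguments.
Unset Strict Implicit.
Unset Printing Implicit Defensive.
Import Order.TTheory GRing.Theory Num.Theory.
Import numFieldNormedType.Exports.
Local Open Scope classical_set_scope.
Local Open Scope ring_scope.

(** Write [s = c^2], [p = (1 + alpha) / 2], [D = p + (1 - p) s] and
    [Z = |T x - theta|^2 / vY].

    The loss of a Gaussian density with mean [t] and variance [s vY] is explicit.
    The geometric mixture of the densities of N(t, s vY) and N(theta, vY) with
    weights [p] and [1 - p] is a multiple of a Gaussian density
    ([tilt_gauss_pdf]), so that its integral is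
      [exp ((d/2) ((1 - p) ln s - ln D) - p (1 - p) Z / (2 D))],
    and the loss for [-1 < alpha < 1] is [4 / (1 - alpha^2)] times 1 minus this
    number ([alpha_lossE]). The Kullback-Leibler loss is minus the derivative of
    this integral at [p = 0] ([kl_lossE]).

    Inflating the variance divides [Z] by [D > 1] in the exponent, which helps,
    and multiplies the integral by [s^(d (1 - p) / 2) D^(- d / 2) <= 1], which
    hurts. By convexity of the exponential the help is at least a multiple of
    [Z exp (- p (1 - p) Z / 2)], whose expectation is at least [epsilon alpha];
    the harm is bounded by a constant ([affinity_gain]). The loss inequality is
    thus affine in a statistic with controlled expectation, and integrates to a
    strict inequality of risks ([lt_integral_gain]).

    The condition [s <= k_bound] says that [s] lies below the larger root of a
    quadratic polynomial, i.e. [d (s - 1) D <= (1 - p) epsilon s]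
    ([k_bound_quadratic]). This is what makes the help exceed the harm.
    For [alpha <= alpha0 <= 0] the condition at [alpha0] implies the one at
    [alpha], because [p / (1 - p)] increases with [alpha] and [1 - alpha^2]
    increases on [-1, 0]; at [alpha = -1] it gives [d (s - 1) <= epsilon <= E Z],
    which together with [ln s < s - 1] settles the Kullback-Leibler loss. *)

(** * Geometric mixtures of two Gaussian densities *)

Section tilt.
Context (R : realType) (d : nat).
Implicit Types (x y t theta : d.-tuple R) (p s v z : R).

(** [tilt_scale s p / (s * v)] is the precision of the geometric mixture, with
    weights [p] and [1 - p], of Gaussians of variances [s * v] and [v]. *)
Definition tilt_scale s p : R := p + (1 - p) * s.

(** The logarithm of the integral of [q1^p q2^(1-p)], where [q1] and [q2] are
    Gaussian densities with variances [s v] and [v] and [z] is the squared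
    distance of their means divided by [v] ([integral_tilt]). *)
Definition log_affinity s z p : R :=
  d%:R / 2 * ((1 - p) * ln s - ln (tilt_scale s p))
  - p * (1 - p) * z / (2 * tilt_scale s p).

Definition log_ratio v s t theta y : R :=
  ln (gauss_pdf t (s * v) y / gauss_pdf theta v y).

Lemma gauss_pdfE theta v y : 0 < v ->
  gauss_pdf theta v y =
  expR (- (d%:R / 2 * ln (2 * pi * v)) - sqdist y theta / (2 * v)).
Proof.
move=> v0; rewrite /gauss_pdf expRD; congr (_ * _); last by rewrite mulNr.
by rewrite /powR gt_eqF ?mulr_gt0 ?pi_gt0// mulNr.
Qed.

Lemma gauss_pdf_gt0 theta v y : 0 < v -> 0 < gauss_pdf theta v y.
Proof. by move=> v0; rewrite gauss_pdfE// expR_gt0. Qed.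

Lemma log_ratioE v s t theta y : 0 < v -> 0 < s ->
  log_ratio v s t theta y =
  - (d%:R / 2 * ln s) + sqdist y theta / (2 * v) - sqdist y t / (2 * (s * v)).
Proof.
move=> v0 s0; rewrite /log_ratio !gauss_pdfE ?mulr_gt0// -expRN -expRD expRK.
have -> : 2 * pi * (s * v) = s * (2 * pi * v) by ring.
rewrite lnM ?posrE ?mulr_gt0 ?pi_gt0//.
set L := ln s; set M := ln _; ring.
Qed.

Definition tilt_mean s p t theta : d.-tuple R :=
  [tuple (p * tnth t i + (1 - p) * s * tnth theta i) / tilt_scale s p | i < d].

(** Completing the square, one coordinate at a time. *)
Lemma sqdist_tilt s p t theta y : 0 < s -> tilt_scale s p != 0 ->
  p * sqdist y t / s + (1 - p) * sqdist y theta =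
  tilt_scale s p / s * sqdist y (tilt_mean s p t theta)
  + p * (1 - p) / tilt_scale s p * sqdist t theta.
Proof.
move=> s0 D0; rewrite [p * _ / s]mulrAC /sqdist !mulr_sumr -!big_split/=.
apply: eq_bigr => i _; rewrite tnth_mktuple.
move: D0; rewrite /tilt_scale => D0.
by field; rewrite D0 gt_eqF.
Qed.

(** The left-hand side is [q1^p q2^(1-p)], written with a logarithm so that it
    makes sense for negative [p] as well. *)
Lemma tilt_gauss_pdf v s p t theta y :
  0 < v -> 0 < s -> 0 < tilt_scale s p ->
  expR (p * log_ratio v s t theta y) * gauss_pdf theta v y =
  expR (log_affinity s (sqdist t theta / v) p) *
  gauss_pdf (tilt_mean s p t theta) (v * s / tilt_scale s p) y.
Proof.
move=> v0 s0 D0; rewrite log_ratioE// !gauss_pdfE ?mulr_gt0 ?invr_gt0//.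
rewrite -!expRD; congr expR.
have -> : 2 * pi * (v * s / tilt_scale s p) =
          (2 * pi * v) * (s / tilt_scale s p).
  by ring.
rewrite [ln (_ * (_ / _))]lnM ?ln_div ?posrE ?divr_gt0 ?mulr_gt0 ?pi_gt0//.
rewrite /log_affinity.
have := sqdist_tilt t theta y s0 (lt0r_neq0 D0).
set L := ln s; set M := ln (2 * _ * _); set N := ln (tilt_scale _ _).
set D := tilt_scale s p in D0 *.
set A := sqdist y t; set B := sqdist y theta; set E := sqdist y _.
set F := sqdist t theta => H.
(* All logarithms cancel; what remains is the multiple of [H] by [1 / (2 v)]. *)
apply/eqP; rewrite -subr_eq0; apply/eqP.
transitivity ((2 * v)^-1 * (D / s * E + p * (1 - p) / D * F
                            - (p * A / s + (1 - p) * B))).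
  by field; rewrite !gt_eqF.
by rewrite H subrr mulr0.
Qed.


Local Notation leb := (lebesgue_tuple d).

Lemma integral_gauss_pdf theta v : 0 < v ->
  (\int[leb]_y (gauss_pdf theta v y)%:E = 1)%E.
Proof. exact: gauss_law_setT. Qed.

Lemma integrable_gauss_pdf theta v : 0 < v ->
  leb.-integrable setT (fun y => (gauss_pdf theta v y)%:E).
Proof.
move=> v0; apply/integrableP; split.
  by apply/measurable_EFinP; exact: measurable_gauss_pdf.
under eq_integral => y _ do rewrite gee0_abs ?lee_fin ?gauss_pdf_ge0//.
by rewrite integral_gauss_pdf// ltry.
Qed.

Lemma tilt_scale_ge1 s p : 1 <= s -> p <= 1 -> 1 <= tilt_scale s p.
Proof. by move=> s1 p1; rewrite /tilt_scale; nra. Qed.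

Lemma tilt_scale_gt0 s p : 1 <= s -> p <= 1 -> 0 < tilt_scale s p.
Proof. by move=> s1 p1; rewrite (lt_le_trans ltr01)// tilt_scale_ge1. Qed.

Lemma measurable_sqdist d' (E : measurableType d') (f : E -> d.-tuple R) x :
  measurable_fun setT f -> measurable_fun setT (fun w => sqdist (f w) x).
Proof.
move=> mf; apply: measurable_sum => i; apply: measurable_funX.
apply: measurable_funB => //.
exact: (measurableT_comp (measurable_tnth i) mf).
Qed.

Lemma measurable_log_ratio v s t theta : 0 < v -> 0 < s ->
  measurable_fun setT (log_ratio v s t theta).
Proof.
move=> v0 s0; rewrite (funext (fun y => log_ratioE t theta y v0 s0)).
by apply: measurable_funB; [apply: measurable_funD|] => //;
  apply: measurable_funM => //; exact: measurable_sqdist.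
Qed.

Lemma integrable_tilt v s p t theta : 0 < v -> 1 <= s -> p <= 1 ->
  leb.-integrable setT
    (fun y => (expR (p * log_ratio v s t theta y) * gauss_pdf theta v y)%:E).
Proof.
move=> v0 s1 p1; have s0 : 0 < s by apply: lt_le_trans s1.
have D0 := tilt_scale_gt0 s1 p1.
under [X in integrable _ _ X]funext do rewrite tilt_gauss_pdf// EFinM.
by apply: integrableZl => //; apply: integrable_gauss_pdf;
  rewrite divr_gt0 ?mulr_gt0.
Qed.

Lemma integral_tilt v s p t theta : 0 < v -> 1 <= s -> p <= 1 ->
  (\int[leb]_y (expR (p * log_ratio v s t theta y) * gauss_pdf theta v y)%:E =
   (expR (log_affinity s (sqdist t theta / v) p))%:E)%E.
Proof.
move=> v0 s1 p1; have s0 : 0 < s by apply: lt_le_trans s1.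
have D0 := tilt_scale_gt0 s1 p1.
have w0 : 0 < v * s / tilt_scale s p by rewrite divr_gt0 ?mulr_gt0.
under eq_integral do rewrite tilt_gauss_pdf// EFinM.
rewrite integralZl//; last exact: integrable_gauss_pdf.
by rewrite integral_gauss_pdf// mule1.
Qed.

Lemma is_derive_tilt_scale (s p : R) : is_derive p 1 (tilt_scale s) (1 - s).
Proof.
by apply: is_derive_eq; rewrite /GRing.scale/=; ring.
Qed.

Lemma is_derive_log_affinity (s z p : R) : 0 < tilt_scale s p ->
  is_derive p 1 (log_affinity s z)
    (d%:R / 2 * (- ln s - (1 - s) / tilt_scale s p)
     - z / 2 * ((1 - p - p) / tilt_scale s p
                - p * (1 - p) * (1 - s) / tilt_scale s p ^+ 2)).
Proof.
move=> D0.
have dD := is_derive_tilt_scale s p.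
have dln : is_derive p 1 (@ln R \o tilt_scale s) ((tilt_scale s p)^-1 * (1 - s)).
  by apply: is_derive1_comp; exact: is_derive1_ln.
have dinv : is_derive p 1 (fun q => (tilt_scale s q)^-1) 
    (- (tilt_scale s p) ^- 2 *: (1 - s)).
  by apply: is_deriveV; rewrite // gt_eqF.
have -> : log_affinity s z = fun q =>
  d%:R / 2 * ((1 - q) * ln s - (@ln R \o tilt_scale s) q)
  - z / 2 * (q * (1 - q) * (tilt_scale s q)^-1).
  by apply/funext => q; rewrite /log_affinity invfM /=; ring.
apply: is_derive_eq; rewrite /GRing.scale/=.
by field; rewrite gt_eqF.
Qed.

Lemma log_affinity0 s z : log_affinity s z 0 = 0.
Proof.
by rewrite /log_affinity /tilt_scale subr0 !mul1r add0r !mul0r subrr mulr0 subr0.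
Qed.

Lemma is_derive_affinity s z p : 0 < tilt_scale s p ->
  is_derive p 1 (expR \o log_affinity s z) (expR (log_affinity s z p) *
    (d%:R / 2 * (- ln s - (1 - s) / tilt_scale s p)
     - z / 2 * ((1 - p - p) / tilt_scale s p
                - p * (1 - p) * (1 - s) / tilt_scale s p ^+ 2))).
Proof.
move=> D0; apply: is_derive1_comp; exact: is_derive_log_affinity.
Qed.

(** * Closed forms of the losses *)

Lemma alpha_lossE alpha v s t theta : -1 < alpha < 1 -> 0 < v -> 1 <= s ->
  alpha_loss alpha v theta (gauss_pdf t (s * v)) =
  (4 / (1 - alpha ^+ 2) *
   (1 - expR (log_affinity s (sqdist t theta / v) ((1 + alpha) / 2))))%:E.
Proof.
move=> /andP[aN1 a1] v0 s1; have s0 : 0 < s by apply: lt_le_trans s1.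
rewrite /alpha_loss /alpha_h gt_eqF//.
set k := 4 / _; set p := (1 + _) / 2.
have p1 : p <= 1 by rewrite /p; lra.
have := integrable_tilt t theta v0 s1 p1.
have := integral_tilt t theta v0 s1 p1.
set f := fun y => _ => intf intgf.
transitivity (\int[leb]_y (k%:E * ((gauss_pdf theta v y)%:E - f y)))%E.
  apply: eq_integral => y _; rewrite /f -EFinB -EFinM -mulrA mulrBl mul1r.
  congr (_ * (_ - _ * _))%:E.
  by rewrite /powR gt_eqF// divr_gt0 ?gauss_pdf_gt0 ?mulr_gt0.
rewrite integralZl//; last exact/integrableB/intgf/integrable_gauss_pdf.
rewrite integralB//; last exact: integrable_gauss_pdf.
by rewrite integral_gauss_pdf// intf.
Qed.

(** With [V = ln (q1 / q2)], the bound [1 + p V <= exp (p V)] integrates to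
    [1 <= G p + p m], where [G] is the closed form of [integral_tilt] and [m] is
    the loss. Equality holds at [p = 0], which is interior to the range
    [p <= 1] of that closed form, so [p = 0] is a minimum and [m = - G'(0)]. This
    avoids computing second moments of Gaussian vectors. *)
Lemma kl_lossE v s t theta : 0 < v -> 1 <= s ->
  alpha_loss (-1) v theta (gauss_pdf t (s * v)) =
  (d%:R / 2 * (ln s + s^-1 - 1) + sqdist t theta / v / (2 * s))%:E.
Proof.
move=> v0 s1; have s0 : 0 < s by apply: lt_le_trans s1.
rewrite /alpha_loss /alpha_h eqxx.
set V := fun y => log_ratio v s t theta y; pose q := gauss_pdf theta v.
pose G p := expR (log_affinity s (sqdist t theta / v) p).
(* [|V| <= exp V + exp (- V)], the mixtures with [p = 1] and [p = -1]. *)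
have intV : leb.-integrable setT (fun y => (- V y * q y)%:E).
  have i1 := integrable_tilt t theta v0 s1 (lexx 1).
  have N11 : -1 <= 1 :> R by lra.
  have iN1 := integrable_tilt t theta v0 s1 N11.
  apply: le_integrable (integrableD measurableT i1 iN1) => //.
    apply/measurable_EFinP; apply: measurable_funM => //; last first.
      exact: measurable_gauss_pdf.
    apply: measurable_funN.
    exact: measurable_log_ratio.
  move=> y _ /=; rewrite lee_fin -mulrDl !normrM.
  rewrite ler_wpM2r// mul1r mulN1r.
  rewrite [leRHS]ger0_norm ?addr_ge0 ?expR_ge0// -/(V y) normrN ler_norml.
  have := expR_ge1Dx (V y); have := expR_ge1Dx (- V y).
  have := expR_ge0 (V y); have := expR_ge0 (- V y).
  lra.
have [m mE] : exists m, (\int[leb]_y (- V y * q y)%:E = m%:E)%E.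
  exists (fine (\int[leb]_y (- V y * q y)%:E)%E).
  by rewrite fineK//; exact: integrable_fin_num intV.
rewrite [LHS]mE; congr EFin.
have iq : leb.-integrable setT (fun y => (q y)%:E) by exact: integrable_gauss_pdf.
pose f p := G p + p * m.
have f_min p : p <= 1 -> 1 <= f p.
  move=> p1; rewrite /f -lerBlDr -lee_fin -(integral_tilt _ _ v0 s1 p1) EFinB EFinM.
  rewrite -(integral_gauss_pdf theta v0) -mE.
  have ipV := integrableZl measurableT p intV.
  rewrite -integralZl// -integralB//.
  apply: le_integral => //; [exact: integrableB|exact: integrable_tilt|].
  move=> y _; rewrite -EFinM -EFinB lee_fin mulrA -[X in X - _]mul1r -mulrBl.
  by rewrite ler_wpM2r ?gauss_pdf_ge0// mulrN opprK expR_ge1Dx.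
have f0 : f 0 = 1 by rewrite /f /G log_affinity0 expR0 mul0r addr0.
have df p D : is_derive p 1 G D -> is_derive p 1 f (D + m).
  move=> dG; rewrite /f; apply: is_derive_eq.
  by rewrite /GRing.scale/= mulr0 add0r mulr1.
have dG p (p1 : p < 1) :=
  is_derive_affinity (sqdist t theta / v) (tilt_scale_gt0 s1 (ltW p1)).
have [_ f'0] : is_derive (0 : R) 1 f 0.
  apply: (@derive1_at_min _ f (-1) 1 0).
  - lra.
  - by move=> p; rewrite in_itv/= => /andP[_ p1]; have [] := df _ _ (dG _ p1).
  - by rewrite in_itv/=; lra.
  - by move=> p; rewrite in_itv/= f0 => /andP[_ /ltW]; exact: f_min.
have [_] := df _ _ (dG 0 ltr01); rewrite f'0 log_affinity0 expR0 => /eqP.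
rewrite eq_sym addr_eq0 => /eqP mE'.
rewrite -[m]opprK -mE' /tilt_scale subr0 add0r mul1r.
by field; rewrite !gt_eqF.
Qed.

End tilt.

(** * Inequalities for the closed forms *)

Section gain.
Context (R : realType).
Implicit Types (a b c p s w x z : R).

Lemma le_quadratic_root a b c s : 0 < a -> 0 <= c -> 0 < s ->
  s <= (b + Num.sqrt (b ^+ 2 + 4 * (a * c))) / (2 * a) ->
  a * s ^+ 2 <= b * s + c.
Proof.
move=> a0 c0 s0; rewrite ler_pdivlMr ?mulr_gt0// addrC -lerBlDr => h.
have [h0|h0] := leP 0 (s * (2 * a) - b); last first.
  have : s * (a * s - b) <= 0 by rewrite pmulr_rle0//; nra.
  by nra.
have disc0 : 0 <= b ^+ 2 + 4 * (a * c).
  by rewrite addr_ge0 ?sqr_ge0// !mulr_ge0// ltW.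
have : (s * (2 * a) - b) ^+ 2 <= b ^+ 2 + 4 * (a * c).
  by rewrite -(sqr_sqrtr disc0) ler_sqr ?nnegrE ?sqrtr_ge0.
move=> {}h; have : a * (a * s ^+ 2 - (b * s + c)) <= 0 by lra.
by rewrite pmulr_rle0// subr_le0.
Qed.

Lemma ln_le_subr1 x : 0 < x -> ln x <= x - 1.
Proof. by move=> x0; rewrite -[x in ln x](subrKC 1) le_ln1Dx//; lra. Qed.

(** Integrating the geometric mixture of two probability densities gives at
    most 1; in closed form, the logarithmic part is weighted AM-GM for 1 and
    [s], obtained from [ln x <= x - 1] at [1 / D] and [s / D]. *)
Lemma log_affinity_le0 d s z p : 0 <= p <= 1 -> 1 <= s -> 0 <= z ->
  log_affinity d s z p <= 0.
Proof.
move=> /andP[p0 p1] s1 z0; have s0 : 0 < s by apply: lt_le_trans s1.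
have D0 : 0 < tilt_scale s p by exact: tilt_scale_gt0.
have h1 : ln (tilt_scale s p)^-1 <= (tilt_scale s p)^-1 - 1.
  by rewrite ln_le_subr1// invr_gt0.
have h2 : ln (s / tilt_scale s p) <= s / tilt_scale s p - 1.
  by rewrite ln_le_subr1// divr_gt0.
have : p * ln (tilt_scale s p)^-1 + (1 - p) * ln (s / tilt_scale s p) <= 0.
  apply: le_trans (lerD (ler_wpM2l p0 h1) (ler_wpM2l _ h2)) _; first by lra.
  rewrite le_eqVlt; apply/orP; left; apply/eqP; rewrite /tilt_scale in D0 *.
  by field; rewrite gt_eqF.
rewrite lnV ?posrE// ln_div ?posrE// => h.
rewrite /log_affinity subr_le0; apply: (@le_trans _ _ 0).
  by rewrite mulr_ge0_le0//; lra.
by rewrite divr_ge0 ?mulr_ge0 ?(ltW D0)//; lra.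
Qed.

(** The constant 1/2 on the right is what makes the bound [k_bound] reachable:
    two applications of [ln x <= x - 1] would only give the same bound without
    it. Both sides vanish at [s = 1]; the derivatives in [s] compare because
    [2 s <= (s + 1) D], which needs [p <= 1/2], that is [alpha <= 0]. *)
Lemma ln_tilt_scale_le s p : 0 <= p <= 2^-1 -> 1 <= s ->
  ln (tilt_scale s p) - (1 - p) * ln s
  <= p * (1 - p) * (s - 1) ^+ 2 / (2 * s).
Proof.
move=> /andP[p0 p12] s1.
pose F u := p * (1 - p) / 2 * (u + u^-1 - 2) + (1 - p) * ln u
            - (@ln R \o (fun q : R => tilt_scale q p)) u.
have dF (u : R) : 1 <= u -> is_derive u 1 F
    (p * (1 - p) / 2 * (1 - u ^- 2) + (1 - p) / u - (1 - p) / tilt_scale u p).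
  move=> u1; have u0 : 0 < u by apply: lt_le_trans u1.
  have D0 : 0 < tilt_scale u p by rewrite tilt_scale_gt0//; lra.
  have dln : is_derive u 1 (@ln R) u^-1 by exact: is_derive1_ln.
  have dD : is_derive u 1 (fun q : R => tilt_scale q p) (1 - p).
    by apply: is_derive_eq; rewrite /GRing.scale/=; ring.
  have dlnD : is_derive u 1 (@ln R \o (fun q : R => tilt_scale q p))
      ((tilt_scale u p)^-1 * (1 - p)).
    by apply: is_derive1_comp; exact: is_derive1_ln.
  have dinv : is_derive u 1 (fun q : R => q^-1) (- u ^- 2 *: 1).
    by apply: is_deriveV; rewrite // gt_eqF.
  apply: is_derive_eq; rewrite /GRing.scale/=.
  by field; rewrite !gt_eqF.
have : F 1 <= F s.
  have [->//|s1'] := eqVneq s 1.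
  have {}s1' : 1 < s by rewrite lt_neqAle eq_sym s1'.
  apply: (@ger0_derive1_ndecr _ F 1 s); last 3 first.
  - exact: lexx.
  - exact: s1.
  - exact: lexx.
  - by move=> u; rewrite in_itv/= => /andP[/ltW/dF[]].
  - move=> u; rewrite in_itv/= => /andP[/ltW u1 _].
    have [_] := dF _ u1; rewrite derive1E => ->.
    have u0 : 0 < u by apply: lt_le_trans u1.
    have D0 : 0 < tilt_scale u p by rewrite tilt_scale_gt0//; lra.
    rewrite [leRHS](_ : _ = p * (1 - p) * (u - 1) *
      ((u + 1) * tilt_scale u p - 2 * u) / (2 * u ^+ 2 * tilt_scale u p)).
      have -> : (u + 1) * tilt_scale u p - 2 * u = (u - 1) * ((1 - p) * u - p).
        by rewrite /tilt_scale; ring.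
      apply: divr_ge0; last by rewrite ltW// !mulr_gt0 ?exprn_gt0.
      have pu : 0 <= (1 - p) * u - p by nra.
      by rewrite !mulr_ge0//; lra.
    by rewrite /tilt_scale in D0 *; field; rewrite !gt_eqF.
  - apply: derivable_within_continuous => u; rewrite in_itv/= => /andP[u1 _].
    by have [] := dF _ u1.
have s0 : 0 < s by apply: lt_le_trans s1.
have e1 : p + (1 - p) * 1 = 1 by ring.
rewrite /F /= /tilt_scale e1 ln1 invr1.
have -> : p * (1 - p) * (s - 1) ^+ 2 / (2 * s) = p * (1 - p) / 2 * (s + s^-1 - 2).
  by field; rewrite gt_eqF.
by lra.
Qed.

(** The statistic [w] stands for [z exp (- p (1 - p) z / 2)] or anything smaller,
    so that one statistic can serve several values of [p]. With
    [b = - p (1 - p) z / 2] and [K z = b / D - b], the left-hand side comes from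
    [exp (b + K z) >= exp b (1 + K z)], and [W] from
    [s^(d (1 - p) / 2) D^(- d / 2) >= exp (- W / 2) >= 1 - W / 2], which is
    [ln_tilt_scale_le]. *)
Lemma affinity_gain d s p z w : 0 <= p <= 2^-1 -> 1 <= s -> 0 <= z ->
  let W := d%:R * p * (1 - p) * (s - 1) ^+ 2 / (2 * s) in
  W <= 2 -> w <= z * expR (- (p * (1 - p) * z / 2)) ->
  (1 - W / 2) * (p * (1 - p) / 2 * ((1 - p) * (s - 1) / tilt_scale s p)) * w
  <= expR (log_affinity d s z p) - expR (log_affinity d 1 z p) + W / 2.
Proof.
move=> p012 s1 z0 W W2 hw; have /andP[p0 p12] := p012.
have s0 : 0 < s by apply: lt_le_trans s1.
have D0 : 0 < tilt_scale s p by rewrite tilt_scale_gt0//; lra.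
have -> : log_affinity d 1 z p = - (p * (1 - p) * z / 2).
  have e1 : tilt_scale 1 p = 1 by rewrite /tilt_scale; ring.
  by rewrite /log_affinity e1 ln1; lra.
set b := - (p * _ * z / 2) in hw *.
set K := p * (1 - p) / 2 * _.
have K0 : 0 <= K by rewrite /K !mulr_ge0 ?invr_ge0//; lra.
pose L := d%:R / 2 * (ln (tilt_scale s p) - (1 - p) * ln s).
have -> : log_affinity d s z p = - L + (b + K * z).
  rewrite /log_affinity /L /K /b.
  move: D0; rewrite /tilt_scale => D0.
  set l1 := ln s; set l2 := ln _.
  by field; rewrite gt_eqF.
have LW : L <= W / 2.
  have d0 : 0 <= d%:R / 2 :> R by rewrite divr_ge0.
  have := ler_wpM2l d0 (ln_tilt_scale_le p012 s1); rewrite -/L => /le_trans; apply.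
  by rewrite le_eqVlt; apply/orP; left; apply/eqP; rewrite /W; field; rewrite gt_eqF.
have eL : 1 - W / 2 <= expR (- L) by apply: le_trans (expR_ge1Dx _); lra.
have eK : expR b * (1 + K * z) <= expR (b + K * z).
  by rewrite expRD ler_wpM2l ?expR_ge0// expR_ge1Dx.
have W0 : 0 <= W by rewrite /W !mulr_ge0 ?invr_ge0//; try lra; rewrite sqr_ge0.
have b1 : expR b <= 1.
  by rewrite -[leRHS]expR0 ler_expR /b oppr_le0 !mulr_ge0//; lra.
rewrite expRD.
have h1 : (1 - W / 2) * (expR b * (1 + K * z)) <= expR (- L) * expR (b + K * z).
  apply: ler_pM => //; first lra.
  by rewrite mulr_ge0 ?expR_ge0// addr_ge0// mulr_ge0.
have h2 : (1 - W / 2) * K * w <= (1 - W / 2) * K * (z * expR b).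
  by rewrite ler_wpM2l// mulr_ge0//; lra.
have h3 : W / 2 * expR b <= W / 2 * 1 by rewrite ler_wpM2l//; lra.
lra.
Qed.

End gain.

(** * From pointwise gains to risks *)

(** The finiteness of the integral of [l2] is what allows subtracting it. *)
Lemma lt_integral_gain d (E : measurableType d) (R : realType)
    (mu : {measure set E -> \bar R}) (l1 l2 w : E -> R) (A B e : R) :
  mu setT = 1%E ->
  measurable_fun setT l1 -> measurable_fun setT l2 -> measurable_fun setT w ->
  (forall x, 0 <= l1 x) -> (forall x, 0 <= l2 x) -> (forall x, 0 <= w x) ->
  0 <= A -> 0 <= B -> (forall x, l1 x + A * w x <= l2 x + B) ->
  (e%:E <= \int[mu]_x (w x)%:E)%E -> B < A * e ->
  (\int[mu]_x (l2 x)%:E < +oo)%E ->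
  (\int[mu]_x (l1 x)%:E < \int[mu]_x (l2 x)%:E)%E.
Proof.
move=> mu1 ml1 ml2 mw l10 l20 w0 A0 B0 gain ew BAe l2y.
have {}ml1 : measurable_fun setT (fun x => (l1 x)%:E) by exact/measurable_EFinP.
have {}ml2 : measurable_fun setT (fun x => (l2 x)%:E) by exact/measurable_EFinP.
have {}mw : measurable_fun setT (fun x => (w x)%:E) by exact/measurable_EFinP.
have mAw : measurable_fun setT (fun x => A%:E * (w x)%:E)%E.
  exact: measurable_funeM.
have Aw0 x : (0 <= A%:E * (w x)%:E)%E by rewrite -EFinM lee_fin mulr_ge0.
have : ((\int[mu]_x (l1 x)%:E) + (A * e)%:E <= (\int[mu]_x (l2 x)%:E) + B%:E)%E.
  apply: (@le_trans _ _ (\int[mu]_x ((l1 x)%:E + A%:E * (w x)%:E))%E).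
    rewrite ge0_integralD//; last by move=> x _; rewrite lee_fin.
    rewrite ge0_integralZl_EFin//; last by move=> x _; rewrite lee_fin.
    by rewrite leeD2l// EFinM lee_wpmul2l ?lee_fin.
  have -> : ((\int[mu]_x (l2 x)%:E) + B%:E = \int[mu]_x ((l2 x)%:E + B%:E))%E.
    rewrite ge0_integralD//; last by move=> x _; rewrite lee_fin.
    by rewrite integral_cst// mu1 mule1.
  apply: ge0_le_integral => //.
  - by move=> x _; rewrite adde_ge0 ?Aw0 ?lee_fin.
  - exact: emeasurable_funD.
  - exact: emeasurable_funD.
  - by move=> x _; rewrite -EFinM -!EFinD lee_fin.
have : (0 <= \int[mu]_x (l1 x)%:E)%E by apply: integral_ge0 => x _; rewrite lee_fin.
have : (0 <= \int[mu]_x (l2 x)%:E)%E by apply: integral_ge0 => x _; rewrite lee_fin.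
move: l2y; case: (\int[mu]_x (l2 x)%:E)%E => [r2| |]//= _ _.
case: (\int[mu]_x (l1 x)%:E)%E => [r1| |]//= _.
by rewrite -!EFinD !lee_fin lte_fin; lra.
Qed.

Section domination.
Context (R : realType) (d : nat) (vX vY : R) (T : d.-tuple R -> d.-tuple R).
Context (vX0 : 0 < vX) (vY0 : 0 < vY) (mT : measurable_fun setT T).
Implicit Types (theta : d.-tuple R) (C : set (d.-tuple R)) (s a alpha e : R).

Definition scaled_error theta x : R := sqdist (T x) theta / vY.

(** The integrand of [epsilon]. *)
Definition damped_error a theta x : R :=
  scaled_error theta x * expR (- ((1 - a ^+ 2) * scaled_error theta x / 8)).

Lemma scaled_error_ge0 theta x : 0 <= scaled_error theta x.
Proof.
apply: divr_ge0; last exact: ltW.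
by apply: sumr_ge0 => i _; exact: sqr_ge0.
Qed.

Lemma damped_error_ge0 a theta x : 0 <= damped_error a theta x.
Proof. by rewrite mulr_ge0 ?scaled_error_ge0// expR_ge0. Qed.

Lemma measurable_scaled_error theta : measurable_fun setT (scaled_error theta).
Proof. by apply: measurable_funM => //; exact: measurable_sqdist. Qed.

Lemma measurable_damped_error a theta :
  measurable_fun setT (damped_error a theta).
Proof.
apply: measurable_funM; first exact: measurable_scaled_error.
apply: measurableT_comp => //; apply: measurable_funN.
by do 2!apply: measurable_funM => //; exact: measurable_scaled_error.
Qed.

(** From [y <= exp y]; this keeps [epsilon] finite, and it also bounds the
    constant [W] of [affinity_gain] in [alpha_risk_lt]. *)
Lemma damped_error_le a theta x : -1 < a < 1 ->
  damped_error a theta x <= 8 / (1 - a ^+ 2).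
Proof.
move=> /andP[aN1 a1]; have a2 : 0 < 1 - a ^+ 2 by nra.
rewrite /damped_error; set z := scaled_error _ _.
have := expR_ge1Dx ((1 - a ^+ 2) * z / 8) => h.
rewrite expRN ler_pdivrMr ?expR_gt0//.
rewrite mulrAC ler_pdivlMr//.
by lra.
Qed.

Lemma epsilon_le_integral C theta a : C theta ->
  (epsilon C vX vY T a <= \int[gauss_law theta vX]_x (damped_error a theta x)%:E)%E.
Proof. by move=> Ctheta; apply: ereal_inf_lbound; exists theta. Qed.

Lemma epsilon_fin_num C theta a : C theta -> -1 < a < 1 ->
  (0 < epsilon C vX vY T a)%E ->
  (fine (epsilon C vX vY T a))%:E = epsilon C vX vY T a /\
  0 < fine (epsilon C vX vY T a) <= 8 / (1 - a ^+ 2).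
Proof.
move=> Ctheta a1 e0.
have : (epsilon C vX vY T a <= (8 / (1 - a ^+ 2))%:E)%E.
  apply: le_trans (epsilon_le_integral a Ctheta) _.
  have <- : (\int[gauss_law theta vX]_x (cst (8 / (1 - a ^+ 2))%:E) x =
             (8 / (1 - a ^+ 2))%:E)%E.
    by rewrite integral_cst//= gauss_law_setT// mule1.
  apply: ge0_le_integral => //.
  - by move=> x _; rewrite lee_fin damped_error_ge0.
  - by apply/measurable_EFinP; exact: measurable_damped_error.
  - by move=> x _; rewrite lee_fin damped_error_le.
by move: e0; case: (epsilon _ _ _ _ _) => //= r; rewrite lee_fin lte_fin => -> ->.
Qed.

(** [k_bound] is the larger root of
    [d (1 - a) s^2 - tau s - d (1 + a)], and unfolding [tau] factors [s - 1] out
    of the terms that do not involve [epsilon]. *)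
Lemma k_bound_quadratic C a s : (0 < d)%N -> -1 < a < 1 -> 0 < s ->
  s <= k_bound C vX vY T a ->
  d%:R * (s - 1) * ((1 + a) + (1 - a) * s)
  <= (1 - a) * fine (epsilon C vX vY T a) * s.
Proof.
move=> d0 /andP[aN1 a1] s0; rewrite /k_bound => hs.
have {}d0 : 0 < d%:R :> R by rewrite ltr0n.
have A0 : 0 < d%:R * (1 - a) by rewrite mulr_gt0//; lra.
have B0 : 0 <= d%:R * (1 + a) by rewrite mulr_ge0//; lra.
have := @le_quadratic_root R _ (tau C vX vY T a) _ s A0 B0 s0.
have -> : 4 * (d%:R * (1 - a) * (d%:R * (1 + a))) =
          4 * d%:R ^+ 2 * (1 - a ^+ 2) :> R by ring.
rewrite [2 * (_ * _)]mulrA => /(_ hs); rewrite /tau.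
by set e := fine _; lra.
Qed.

Lemma measurable_affinity s p theta :
  measurable_fun setT
    (fun x => expR (log_affinity d s (scaled_error theta x) p)).
Proof.
apply: measurableT_comp => //; apply: measurable_funB => //.
by apply: measurable_funM => //; apply: measurable_funM => //;
  exact: measurable_scaled_error.
Qed.

Lemma alpha_riskE alpha theta s : -1 < alpha < 1 -> 1 <= s ->
  alpha_risk alpha vX vY theta (fun x => gauss_pdf (T x) (s * vY)) =
  (\int[gauss_law theta vX]_x (4 / (1 - alpha ^+ 2) *
    (1 - expR (log_affinity d s (scaled_error theta x) ((1 + alpha) / 2))))%:E)%E.
Proof.
by move=> a1 s1; apply: eq_integral => x _; rewrite alpha_lossE.
Qed.

Lemma kl_riskE theta s : 1 <= s ->
  alpha_risk (-1) vX vY theta (fun x => gauss_pdf (T x) (s * vY)) =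
  (\int[gauss_law theta vX]_x
    (d%:R / 2 * (ln s + s^-1 - 1) + scaled_error theta x / (2 * s))%:E)%E.
Proof. by move=> s1; apply: eq_integral => x _; rewrite kl_lossE. Qed.

(** [affinity_gain] gives a mean gain proportional to at least
    [(1 - W / 2) K e - W / 2]. The condition on [s] is equivalent to [W <= K e],
    and [W < 1] follows from it because [e] is bounded; hence the gain is
    positive. *)
Lemma alpha_risk_lt alpha alpha0 theta s e : (0 < d)%N ->
  -1 < alpha <= alpha0 -> alpha0 <= 0 -> 1 < s ->
  0 < e <= 8 / (1 - alpha0 ^+ 2) ->
  d%:R * (s - 1) * ((1 + alpha0) + (1 - alpha0) * s) <= (1 - alpha0) * e * s ->
  (e%:E <= \int[gauss_law theta vX]_x (damped_error alpha0 theta x)%:E)%E ->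
  (alpha_risk alpha vX vY theta (fun x => gauss_pdf (T x) (s * vY)) <
   alpha_risk alpha vX vY theta (fun x => gauss_pdf (T x) (1 * vY)))%E.
Proof.
move=> d0 /andP[aN1 aa0] a0 s1 /andP[e0 e8] hs ew.
have a1 : -1 < alpha < 1 by lra.
rewrite !alpha_riskE//; last exact: ltW.
have {}d0 : 0 < d%:R :> R by rewrite ltr0n.
set k := 4 / _; set p := (1 + alpha) / 2.
have k0 : 0 < k by rewrite divr_gt0//; nra.
have p0 : 0 < p by rewrite /p; lra.
have p12 : p <= 2^-1 by rewrite /p; lra.
pose D := tilt_scale s p.
have D0 : 0 < D by rewrite tilt_scale_gt0 ?ltW//; lra.
pose W := d%:R * p * (1 - p) * (s - 1) ^+ 2 / (2 * s).
pose K := p * (1 - p) / 2 * ((1 - p) * (s - 1) / D).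
have s0 : 0 < s by apply: lt_trans s1.
(* The condition at [alpha0] implies the one at [alpha]. *)
have key : d%:R * (s - 1) * D <= (1 - p) * e * s.
  have r0 : 0 < 1 - alpha0 by lra.
  have M0 : 0 < d%:R * (s - 1) by rewrite mulr_gt0//; lra.
  have pr : (1 + alpha) * (1 - alpha0) <= (1 + alpha0) * (1 - alpha) by lra.
  have := ler_wpM2l (ltW M0) pr.
  have := ler_wpM2l (_ : 0 <= 1 - alpha) hs.
  rewrite -(ler_pM2l r0) /D /tilt_scale /p.
  set M := d%:R * _ => h1 h2; have {}h1 := h1 ltac:(lra).
  nra.
have W0 : 0 < W by rewrite /W !mulr_gt0 ?invr_gt0 ?exprn_gt0//; lra.
have WKe : W <= K * e.
  rewrite -ler_pdivlMr// in key.
  have c0 : 0 <= p * (1 - p) * (s - 1) / (2 * s).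
    by rewrite divr_ge0 ?mulr_ge0//; lra.
  rewrite (_ : W = p * (1 - p) * (s - 1) / (2 * s) * (d%:R * (s - 1))).
    rewrite (_ : K * e = p * (1 - p) * (s - 1) / (2 * s) * ((1 - p) * e * s / D)).
      exact: ler_wpM2l.
    by rewrite /K; field; rewrite !gt_eqF.
  by rewrite /W; field; rewrite gt_eqF.
have pre : p * (1 - p) * e <= 2.
  rewrite ler_pdivlMr in e8; last by nra.
  have a2 : alpha0 ^+ 2 <= alpha ^+ 2 by nra.
  have := ler_wpM2l (ltW e0) a2.
  by rewrite /p; lra.
have W1 : W < 1.
  apply: le_lt_trans WKe _.
  have q1 : (1 - p) * (s - 1) / D < 1.
    by rewrite ltr_pdivrMr// /D /tilt_scale; lra.
  have q0 : 0 <= (1 - p) * (s - 1) / D.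
    by rewrite divr_ge0 ?mulr_ge0// ?ltW//; lra.
  have -> : K * e = p * (1 - p) * e / 2 * ((1 - p) * (s - 1) / D).
    by rewrite /K; ring.
  have h0 : 0 <= p * (1 - p) * e / 2 by rewrite !mulr_ge0 ?invr_ge0// ?ltW//; lra.
  nra.
have mloss u : measurable_fun setT (fun x => k *
    (1 - expR (log_affinity d u (scaled_error theta x) p))).
  by apply: measurable_funM => //; apply: measurable_funB => //;
    exact: measurable_affinity.
have loss_ge0 u x : 1 <= u ->
    0 <= k * (1 - expR (log_affinity d u (scaled_error theta x) p)).
  move=> u1; rewrite mulr_ge0 ?(ltW k0)// subr_ge0 -[leRHS]expR0 ler_expR.
  by apply: log_affinity_le0 => //; [lra|exact: scaled_error_ge0].
have K0 : 0 <= K by rewrite /K !mulr_ge0 ?invr_ge0// ?ltW//; lra.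
apply: (@lt_integral_gain _ _ _ (gauss_law theta vX) _ _ (damped_error alpha0 theta)
  (k * ((1 - W / 2) * K)) (k * (W / 2)) e).
- exact: gauss_law_setT.
- exact: mloss.
- exact: mloss.
- exact: measurable_damped_error.
- by move=> x; apply: loss_ge0; exact: ltW.
- by move=> x; exact: loss_ge0.
- exact: damped_error_ge0.
- by apply: mulr_ge0; [exact: ltW|apply: mulr_ge0 => //; lra].
- by apply: mulr_ge0; [exact: ltW|lra].
- move=> x.
  have hw : damped_error alpha0 theta x <= scaled_error theta x *
      expR (- (p * (1 - p) * scaled_error theta x / 2)).
    rewrite ler_wpM2l ?scaled_error_ge0// ler_expR.
    have a2 : alpha0 ^+ 2 <= alpha ^+ 2 by nra.
    have := ler_wpM2l (scaled_error_ge0 theta x) a2.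
    by rewrite /p; lra.
  have p012 : 0 <= p <= 2^-1 by rewrite p12 ltW.
  have W2 : W <= 2 by lra.
  have := affinity_gain p012 (ltW s1) (scaled_error_ge0 theta x) W2 hw.
  rewrite -/W -/D -/K => h; have {}h := ler_wpM2l (ltW k0) h.
  by lra.
- exact: ew.
- by rewrite -[ltRHS]mulrA ltr_pM2l//; nra.
- apply: (@le_lt_trans _ _ k%:E); last exact: ltry.
  have <- : (\int[gauss_law theta vX]_x (cst k%:E) x = k%:E)%E.
    by rewrite integral_cst//= gauss_law_setT// mule1.
  apply: ge0_le_integral => //.
  + by move=> x _; rewrite lee_fin loss_ge0.
  + by apply/measurable_EFinP; exact: mloss.
  + by move=> x _; rewrite lee_fin -[leRHS]mulr1 ler_wpM2l ?(ltW k0)//.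
Qed.

(** The gain is exactly affine in [Z]: twice its mean is
    [(1 - 1/s) E Z - d (ln s + 1/s - 1)], and [ln s + 1/s - 1 < (s - 1)^2 / s]. *)
Lemma kl_risk_lt theta s e : (0 < d)%N -> 1 < s ->
  d%:R * (s - 1) <= e ->
  (e%:E <= \int[gauss_law theta vX]_x (scaled_error theta x)%:E)%E ->
  (alpha_risk (-1) vX vY theta (fun x => gauss_pdf (T x) (1 * vY)) < +oo)%E ->
  (alpha_risk (-1) vX vY theta (fun x => gauss_pdf (T x) (s * vY)) <
   alpha_risk (-1) vX vY theta (fun x => gauss_pdf (T x) (1 * vY)))%E.
Proof.
move=> d0 s1 se eZ; rewrite !kl_riskE ?(ltW s1)//.
have {}d0 : 0 < d%:R :> R by rewrite ltr0n.
have s0 : 0 < s by apply: lt_trans s1.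
have ln_lt : ln s < s - 1.
  have l0 := ln_gt0 s1; have := expR_gt1Dx (lt0r_neq0 l0).
  by rewrite lnK ?posrE//; lra.
have ln_ge : 1 - s^-1 <= ln s.
  have := @ln_le_subr1 R s^-1; rewrite invr_gt0 lnV ?posrE// => /(_ s0).
  by lra.
have inv1 : s^-1 < 1 by rewrite invf_lt1.
have mloss u : measurable_fun setT (fun x =>
    d%:R / 2 * (ln u + u^-1 - 1) + scaled_error theta x / (2 * u)).
  apply: measurable_funD => //; apply: measurable_funM => //.
  exact: measurable_scaled_error.
move=> fin.
apply: (@lt_integral_gain _ _ _ (gauss_law theta vX) _ _ (scaled_error theta)
  ((1 - s^-1) / 2) (d%:R / 2 * (ln s + s^-1 - 1)) e).
- exact: gauss_law_setT.
- exact: mloss.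
- exact: mloss.
- exact: measurable_scaled_error.
- move=> x; apply: addr_ge0; first by rewrite mulr_ge0//; lra.
  by rewrite divr_ge0 ?scaled_error_ge0// mulr_ge0// ltW.
- move=> x; rewrite ln1 invr1 add0r subrr mulr0 add0r.
  by rewrite divr_ge0 ?scaled_error_ge0.
- exact: scaled_error_ge0.
- lra.
- by rewrite mulr_ge0//; lra.
- move=> x; rewrite ln1 invr1 le_eqVlt; apply/orP; left; apply/eqP.
  by set l := ln s; field; rewrite gt_eqF.
- exact: eZ.
- have is0 : 0 < s^-1 by rewrite invr_gt0.
  have h1 : d%:R * (ln s + s^-1 - 1) < d%:R * (s - 1 + s^-1 - 1).
    by rewrite ltr_pM2l//; lra.
  have h2 : (1 - s^-1) * (d%:R * (s - 1)) <= (1 - s^-1) * e.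
    by rewrite ler_wpM2l//; lra.
  have h3 : s * s^-1 = 1 by rewrite divff// gt_eqF.
  nra.
- exact: fin.
Qed.

End domination.

(* vX and vY are the variances sigma_X^2 and sigma_Y^2. *)
Theorem corollary1 (R : realType) (d : nat) (hd : (0 < d)%N)
    (vX vY : R) (hvX : 0 < vX) (hvY : 0 < vY)
    (C : set (d.-tuple R))
    (T : d.-tuple R -> d.-tuple R) (mT : measurable_fun setT T)
    (ndT : non_degenerate C vX T)
    (alpha0 : R) (halpha0 : -1 < alpha0 <= 0)
    (heps : (0 < epsilon C vX vY T alpha0)%E)
    (c : R) (hc : 1 < c) (hck : 1 < c ^+ 2 <= k_bound C vX vY T alpha0) :
  [/\ no_worse C (-1) vX vY (plugin_density vY T c) (plugin_density vY T 1),
      (exists2 theta, C theta &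
         (alpha_risk (-1) vX vY theta (plugin_density vY T 1) < +oo)%E) ->
      dominates_risk C (-1) vX vY (plugin_density vY T c) (plugin_density vY T 1)
    & forall alpha : R, -1 < alpha <= alpha0 ->
      dominates_risk C alpha vX vY
        (plugin_density vY T c) (plugin_density vY T 1)].
Proof.
(* Over an empty [C] every estimator is vacuously degenerate. *)
have [theta0 Ctheta0] : exists theta, C theta.
  apply: contrapT => C0; apply: ndT; exists [tuple 0 | i < d] => theta Ctheta.
  by case: C0; exists theta.
have /andP[aN1 a0] := halpha0.
have a01 : -1 < alpha0 < 1 by lra.
have /andP[s1 sk] := hck.
have s0 : 0 < c ^+ 2 by apply: lt_trans s1.
have [eE e08] := epsilon_fin_num hvX hvY mT Ctheta0 a01 heps.
have ks := k_bound_quadratic hd a01 s0 sk.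
set e := fine _ in eE e08 ks.
have ew theta : C theta ->
    (e%:E <= \int[gauss_law theta vX]_x (damped_error vY T alpha0 theta x)%:E)%E.
  by move=> Ctheta; rewrite eE; exact: epsilon_le_integral.
have eZ theta : C theta ->
    (e%:E <= \int[gauss_law theta vX]_x (scaled_error vY T theta x)%:E)%E.
  move=> /ew/le_trans; apply; apply: ge0_le_integral => //.
  - by move=> x _; rewrite lee_fin damped_error_ge0.
  - by apply/measurable_EFinP; exact: measurable_damped_error.
  - by apply/measurable_EFinP; exact: measurable_scaled_error.
  - move=> x _; rewrite lee_fin -[leRHS]mulr1 ler_wpM2l ?scaled_error_ge0//.
    rewrite -[leRHS]expR0 ler_expR oppr_le0 divr_ge0// mulr_ge0 ?scaled_error_ge0//.
    by nra.
have kl : forall theta, C theta ->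
    (alpha_risk (-1) vX vY theta (plugin_density vY T 1) < +oo)%E ->
    (alpha_risk (-1) vX vY theta (plugin_density vY T c) <
     alpha_risk (-1) vX vY theta (plugin_density vY T 1))%E.
  move=> theta; rewrite /plugin_density expr1n => Ctheta.
  apply: kl_risk_lt (eZ _ Ctheta) => //.
  have /andP[e0 _] := e08.
  (* [(1 - alpha0) s] is smaller than the factor [2 D] of [d (s - 1)] in [ks]. *)
  rewrite -(ler_pM2r (_ : 0 < (1 + alpha0) + (1 - alpha0) * c ^+ 2)); last first.
    by rewrite addr_gt0 ?mulr_gt0//; lra.
  apply: le_trans ks _; rewrite mulrDr; nra.
(* An infinite plug-in risk is no obstacle for the weak inequality. *)
have kl_le : no_worse C (-1) vX vY (plugin_density vY T c) (plugin_density vY T 1).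
  move=> theta Ctheta.
  have [<-|] := eqVneq +oo%E (alpha_risk (-1) vX vY theta (plugin_density vY T 1)).
    by rewrite leey.
  by rewrite eq_sym -ltey => /(kl _ Ctheta)/ltW.
have alpha_lt alpha theta : -1 < alpha <= alpha0 -> C theta ->
    (alpha_risk alpha vX vY theta (plugin_density vY T c) <
     alpha_risk alpha vX vY theta (plugin_density vY T 1))%E.
  move=> ha Ctheta; rewrite /plugin_density expr1n.
  exact: alpha_risk_lt e08 ks (ew _ Ctheta).
split=> [//|[theta Ctheta /(kl _ Ctheta) fin]|alpha ha].
  by split=> //; exists theta.
split; last by exists theta0 => //; exact: alpha_lt.
by move=> theta Ctheta; apply/ltW/alpha_lt.
Qed.
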